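(* For all partial Boolean functions $f:D\to\{0,1\}$ with $D\subseteq\{0,1\}^n$, we have $\mathrm{QS}(f)\le \mathrm{QSZK}(f)$.
   Context: Query model: for $x\in\{0,1\}^n$ the quantum oracle $O_x$ acts by $O_x|i,b\rangle=|i,b\oplus x_i\rangle$ for $i\in[n]$, $b\in\{0,1\}$ (tensored with the identity on other registers). A $T$-query quantum algorithm is given by input-independent unitaries $U_0,\dots,U_T$ on $m$ qubits. On input $x$ it prepares $|\psi_x\rangle=U_TO_xU_{T-1}O_x\cdots U_1O_xU_0|0^m\rangle$, and it may output the mixed state obtained by tracing out a fixed subset of the qubits. The trace distance is $\|\rho-\sigma\|_{tr}=\tfrac12\|\rho-\sigma\|_1$. $\mathrm{QS}(f)$ is the smallest $k$ such that some $k$-query quantum algorithm, on each input $x\in D$, outputs a state $\rho_x$ with $\|\rho_x-\rho_y\|_{tr}\ge 1/6$ whenever $x,y\in D$ and $f(x)\ne f(y)$. $\mathrm{QSZK}(f)$ is the smallest $k$ such that there exist two quantum query algorithms, making $k$ queries in total, that on input $x\in D$ output states $\rho_x$ and $\sigma_x$ of the same dimension satisfying: - $\|\rho_x-\sigma_x\|_{tr}\ge 2/3$ for all $x\in D$ with $f(x)=1$; - $\|\rho_x-\sigma_x\|_{tr}\le 1/3$ for all $x\in D$ with $f(x)=0$. *)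

(* Defs.v *)
From HB Require Import structures.
From mathcomp Require Import all_boot all_order all_algebra.
From mathcomp Require Import complex Rstruct.
From mathcomp Require Import spectral.

Set Implicit Arguments.
Unset Strict Implicit.
Unset Printing Implicit Defensive.

Import Order.TTheory GRing.Theory Num.Theory Num.Def.
Local Open Scope ring_scope.

Definition C : numClosedFieldType := Rdefinitions.R[i].

(* ||A||_1 = Tr sqrt(A^* A) = sum of the square roots of the            *)
(* eigenvalues of the (Hermitian, PSD) matrix A^* A, computed through    *)
(* the spectral decomposition of mathcomp's spectral.v.                 *)
Definition adjmx (d : nat) (A : 'M[C]_d) : 'M[C]_d := (map_mx conjC A)^T.

Definition trace_norm (d : nat) (A : 'M[C]_d) : C :=
  \sum_(i < d) sqrtC (spectral_diag (adjmx A *m A) 0 i).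

Definition trace_dist (d : nat) (rho sigma : 'M[C]_d) : C :=
  trace_norm (rho - sigma) / 2%:R.

(* Registers of a query algorithm.                                      *)
(*   - index register: q qubits, basis 'I_(2^q) (index i in binary),     *)
(*   - answer qubit b : bool,                                            *)
(*   - p output qubits and g further work qubits.                        *)
Definition outb (p : nat) : finType := {ffun 'I_p -> bool}.

Definition basis (q p g : nat) : finType :=
  ('I_(2 ^ q) * bool * (outb p * {ffun 'I_g -> bool}))%type.

Definition dim (q p g : nat) : nat := #|{: basis q p g}|.

Lemma two_exp_gt0 (q : nat) : (0 < 2 ^ q)%N.
Proof. by rewrite expn_gt0. Qed.

Definition idx0 (q : nat) : 'I_(2 ^ q) := Ordinal (two_exp_gt0 q).

Definition zero_basis (q p g : nat) : basis q p g :=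
  (idx0 q, false, ([ffun => false], [ffun => false])).

(* Query bit: x_i for i in [n]; indices outside [n] (possible when
   n is not a power of 2) are left untouched by the oracle. *)
Definition qbit (n : nat) (x : {ffun 'I_n -> bool}) (i : nat) : bool :=
  if insub i is Some j then x j else false.

Definition oracle_map (n q p g : nat) (x : {ffun 'I_n -> bool})
  (s : basis q p g) : basis q p g :=
  let: (i, b, r) := s in (i, b (+) qbit x i, r).

(* Matrices/vectors on the state space, indexed by the enumeration of
   the basis type (column-vector convention). *)
Definition oracle_mx (n q p g : nat) (x : {ffun 'I_n -> bool}) :
  'M[C]_(dim q p g) :=
  \matrix_(i, j) ((enum_val i == oracle_map x (enum_val j))%:R).

Definition init_vec (q p g : nat) : 'cV[C]_(dim q p g) :=
  \col_i ((enum_val i == zero_basis q p g)%:R).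

Record qalg (n p : nat) := QAlg {
  qa_q : nat;
  qa_g : nat;
  qa_T : nat;
  qa_U : 'I_qa_T.+1 -> 'M[C]_(dim qa_q p qa_g);
  qa_index_ok : (n <= 2 ^ qa_q)%N;
  qa_unitary : forall t, qa_U t \is unitarymx
}.

Fixpoint qa_run (n p : nat) (A : qalg n p) (x : {ffun 'I_n -> bool}) (k : nat)
  : 'cV[C]_(dim (qa_q A) p (qa_g A)) :=
  match k with
  | 0 => @qa_U _ _ A (inord 0) *m init_vec (qa_q A) p (qa_g A)
  | k'.+1 => @qa_U _ _ A (inord k'.+1) *m (@oracle_mx n (qa_q A) p (qa_g A) x *m qa_run A x k')
  end.

Definition qa_state (n p : nat) (A : qalg n p) (x : {ffun 'I_n -> bool}) :=
  @qa_run n p A x (qa_T A).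

(* reduced density matrix of the p output qubits (all other qubits,
   i.e. index register, answer qubit and work qubits, are traced out) *)
Definition reduce (q p g : nat) (psi : 'cV[C]_(dim q p g)) :
  'M[C]_(#|{: outb p}|) :=
  \matrix_(a, a')
    \sum_(i : 'I_(2 ^ q)) \sum_(b : bool) \sum_(r : {ffun 'I_g -> bool})
      psi (enum_rank ((i, b, (enum_val a, r)) : basis q p g)) 0 *
      (psi (enum_rank ((i, b, (enum_val a', r)) : basis q p g)) 0)^*.

Definition qa_output (n p : nat) (A : qalg n p) (x : {ffun 'I_n -> bool}) :=
  reduce (qa_state A x).

(* The two measures.  f : D -> {0,1} is given by f on the set D.       *)

Definition QS_achievable (n : nat) (D : {set {ffun 'I_n -> bool}})
  (f : {ffun 'I_n -> bool} -> bool) (k : nat) : Prop :=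
  exists p (A : qalg n p), qa_T A = k /\
    forall x y, x \in D -> y \in D -> f x != f y ->
      1 / 6%:R <= trace_dist (qa_output A x) (qa_output A y).

Definition QSZK_achievable (n : nat) (D : {set {ffun 'I_n -> bool}})
  (f : {ffun 'I_n -> bool} -> bool) (k : nat) : Prop :=
  exists p (A B : qalg n p), (qa_T A + qa_T B)%N = k /\
    (forall x, x \in D -> f x ->
       2%:R / 3%:R <= trace_dist (qa_output A x) (qa_output B x)) /\
    (forall x, x \in D -> ~~ f x ->
       trace_dist (qa_output A x) (qa_output B x) <= 1 / 3%:R).

(* QS(f) <= QSZK(f), where both are the least achievable k:
   every k achievable for QSZK bounds some k' achievable for QS. *)
Definition QS_le_QSZK (n : nat) (D : {set {ffun 'I_n -> bool}})
  (f : {ffun 'I_n -> bool} -> bool) : Prop :=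
  forall k, QSZK_achievable D f k -> exists2 k', (k' <= k)%N & QS_achievable D f k'.

(* Main.v *)
(* Flip a fair quantum coin, kept as an extra output qubit, and run the algorithm
   for rho_x or the one for sigma_x in superposition according to it.  This takes
   max(T_A, T_B) queries, and the diagonal blocks of the output tau_x with respect
   to the coin are rho_x / 2 and sigma_x / 2, so
     |tau_x - tau_y| >= (|rho_x - rho_y| + |sigma_x - sigma_y|) / 2.
   If f x = 1 and f y = 0, the triangle inequality along rho_x, rho_y, sigma_y,
   sigma_x bounds this below by (2/3 - 1/3) / 2 = 1/6.  The two facts on the trace
   norm used here follow from its duality with contractions,
   |A|_1 = max |Tr (W A)|. *)
From mathcomp Require Import all_boot all_order all_algebra.
From mathcomp Require Import spectral sesquilinear ring.
Require Import Defs.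

Set Implicit Arguments.
Unset Strict Implicit.
Unset Printing Implicit Defensive.

Import Order.TTheory GRing.Theory Num.Theory Num.Def.
Local Open Scope ring_scope.
Local Open Scope sesquilinear_scope.

(* Otherwise unification unfolds [C] to [complex R], whose instances do not match
   syntactically those inferred from [C : numClosedFieldType]. *)
Opaque C.

Local Notation "''[' u , v ]" := (@dotmx C _ u v) : ring_scope.
Local Notation "''[' u ]" := '[u, u] : ring_scope.

(** * Algebra of the conjugate transpose *)

Section ConjTranspose.
Variable F : numClosedFieldType.

Lemma trmxC_mul m n p (A : 'M[F]_(m, n)) (B : 'M[F]_(n, p)) :
  (A *m B)^t* = B^t* *m A^t*.
Proof. by rewrite trmx_mul map_mxM. Qed.

Lemma trmxC1 n : (1%:M : 'M[F]_n)^t* = 1%:M.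
Proof. by rewrite trmx1 map_mx1. Qed.

Lemma trmxCD m n (A B : 'M[F]_(m, n)) : (A + B)^t* = A^t* + B^t*.
Proof. by apply/matrixP=> i j; rewrite !mxE rmorphD. Qed.

Lemma trmxCN m n (A : 'M[F]_(m, n)) : (- A)^t* = - A^t*.
Proof. by apply/matrixP=> i j; rewrite !mxE rmorphN. Qed.

Lemma trmxCZ m n c (A : 'M[F]_(m, n)) : (c *: A)^t* = c^* *: A^t*.
Proof. by apply/matrixP=> i j; rewrite !mxE rmorphM. Qed.

End ConjTranspose.

(** * Duality between the trace norm and contractions *)

Definition contraction d (W : 'M[C]_d) := forall u : 'rV[C]_d, '[u *m W] <= '[u].

Section Spectrum.
Variables (d : nat) (A : 'M[C]_d).
Let V := spectralmx (A^t* *m A).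
Let l := spectral_diag (A^t* *m A).

Let unitaryV : V \is unitarymx. Proof. exact: spectral_unitarymx. Qed.
Let VVt : V *m V^t* = 1%:M. Proof. exact/unitarymxP. Qed.
Let VtV : V^t* *m V = 1%:M. Proof. exact: mulmx1C VVt. Qed.

Let gram_spectral : A^t* *m A = V^t* *m diag_mx l *m V.
Proof.
rewrite -[V^t*](invmx_unitary unitaryV); apply/orthomx_spectralP/normalmxP.
by rewrite trmxC_mul trmxCK.
Qed.

Let gram_diag : V *m A^t* *m (A *m V^t*) = diag_mx l.
Proof.
by rewrite !mulmxA -(mulmxA V) gram_spectral !mulmxA VVt mul1mx -mulmxA VVt mulmx1.
Qed.

Let row_norm i : '[row i (V *m A^t*)] = l 0 i.
Proof.
have /matrixP/(_ i i) := gram_diag; rewrite [RHS]mxE eqxx mulr1n => <-.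
rewrite dotmxE mxE [RHS]mxE; apply: eq_bigr => k _.
by rewrite [in LHS]mxE; congr (_ * _); rewrite -[A *m V^t*]trmxCK trmxC_mul trmxCK !mxE.
Qed.

Let l_ge0 i : 0 <= l 0 i.
Proof. by rewrite -row_norm dnorm_ge0. Qed.

Let trace_normE : trace_norm A = \sum_i sqrtC (l 0 i).
Proof. by rewrite /trace_norm /adjmx map_trmx. Qed.

(* Tr (W A) is the sum of the <(V W)_i, (V A^* )_i> over the rows of the unitary V
   diagonalizing A^* A; the second factor has norm the i-th singular value. *)
Lemma trace_contraction_le (W : 'M[C]_d) :
  contraction W -> `|\tr (W *m A)| <= trace_norm A.
Proof.
move=> contrW; rewrite trace_normE.
have -> : \tr (W *m A) = \sum_i '[row i (V *m W), row i (V *m A^t*)].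
  rewrite -[W *m A]mulmx1 -VtV mulmxA mxtrace_mulC; apply: eq_bigr => i _.
  rewrite -[A in LHS]trmxCK -[_ *m V^t*]mulmxA -trmxC_mul mulmxA dotmxE mxE [RHS]mxE.
  by apply: eq_bigr => k _; rewrite !mxE.
apply: le_trans (ler_norm_sum _ _ _) _; apply: ler_sum => i _.
have CS (u v : 'rV[C]_d) : `|'[u, v]| <= sqrtC '[u] * sqrtC '[v].
  exact: CauchySchwarz_sqrt.
apply: le_trans (CS _ _) _; rewrite row_norm.
rewrite -[leRHS]mul1r ler_wpM2r ?sqrtC_ge0 //.
rewrite -[leRHS]sqrtC1 ler_sqrtC ?qualifE /= ?dnorm_ge0 ?ler01 //.
have -> : row i (V *m W) = row i V *m W by apply: row_mul.
apply: le_trans (contrW _) _.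
by move/row_unitarymxP/(_ i i): unitaryV => ->; rewrite eqxx.
Qed.

(* W is the partial isometry of the polar decomposition: with A^* A = V^* diag(s^2) V,
   take W = V^* diag(1/s) V A^*; the convention 0^-1 = 0 handles singular A. *)
Lemma trace_contraction_attained :
  exists2 W : 'M[C]_d, contraction W & \tr (W *m A) = trace_norm A.
Proof.
pose s i := sqrtC (l 0 i).
have s_ge0 i : 0 <= s i by rewrite sqrtC_ge0.
have sq i : s i ^+ 2 = l 0 i by rewrite sqrtCK.
pose S := diag_mx (\row_i (s i)^-1) : 'M[C]_d.
have St : S^t* = S.
  apply/matrixP=> i j; rewrite !mxE; case: eqVneq => [->|ne].
    by rewrite !mulr1n fmorphV /= (CrealP (ger0_real _)).
  by rewrite !mulr0n rmorph0.
exists (V^t* *m S *m V *m A^t*); last first.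
  rewrite trace_normE -mulmxA gram_spectral !mulmxA mxtrace_mulC !mulmxA VVt mul1mx.
  rewrite -[_ *m V^t*]mulmxA VVt mulmx1 mulmx_diag mxtrace_diag; apply: eq_bigr => i _.
  rewrite !mxE -/(s i) -sq; have [->|nz] := eqVneq (s i) 0; first by rewrite invr0 mul0r.
  by rewrite expr2 mulKf.
move=> u; pose y := u *m V^t*.
(* Pass to coordinates in the eigenbasis of A^* A, where the bound can be checked entry by entry. *)
have -> : '[u] = '[y] by rewrite !dotmxE trmxC_mul trmxCK mulmxA mulmxKtV.
rewrite [leLHS]dotmxE !trmxC_mul !trmxCK St.
have -> : u *m (V^t* *m S *m V *m A^t*) *m (A *m (V^t* *m (S *m V)) *m u^t*)
   = y *m (S *m diag_mx l *m S) *m y^t*.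
  by rewrite -gram_diag trmxC_mul trmxCK !mulmxA.
rewrite !mulmx_diag dotmxE mul_mx_diag !mxE; apply: ler_sum => i _; rewrite !mxE.
rewrite -[leLHS]mulrA [X in _ * X]mulrC mulrA -[leRHS]mulr1 ler_wpM2l ?mul_conjC_ge0 //.
(* The diagonal entry s^-1 s^2 s^-1 is 1 when s is nonzero and 0 otherwise, so it is at most 1. *)
rewrite -sq; have [->|nz] := eqVneq (s i) 0; first by rewrite invr0 mul0r mul0r ler01.
by rewrite expr2 mulKf // mulfV.
Qed.

End Spectrum.

(** * Norm properties and pinching, derived from duality *)

Lemma ler_trace_normD d (A B : 'M[C]_d) : trace_norm (A + B) <= trace_norm A + trace_norm B.
Proof.
have [W contrW trW] := trace_contraction_attained (A + B).
have tn_ge0 : 0 <= trace_norm (A + B).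
  by apply: le_trans (trace_contraction_le _ contrW); rewrite normr_ge0.
(* A contraction optimal for A + B is admissible for A and for B separately. *)
rewrite -(ger0_norm tn_ge0) -trW mulmxDr mxtraceD.
by apply: le_trans (ler_normD _ _) _; apply: lerD; apply: trace_contraction_le.
Qed.

Lemma trace_norm_ge0 d (A : 'M[C]_d) : 0 <= trace_norm A.
Proof.
have [W contrW _] := trace_contraction_attained A.
by apply: le_trans (trace_contraction_le _ contrW); rewrite normr_ge0.
Qed.

(** A contraction optimal for A serves as a test for c A. With c = -1, used for A and for -A, this
    gives invariance under negation. *)
Lemma trace_norm_scale_ge d (c : C) (A : 'M[C]_d) :
  `|c| * trace_norm A <= trace_norm (c *: A).
Proof.
have [W contrW trW] := trace_contraction_attained A.
rewrite -[leLHS]ger0_norm ?mulr_ge0 ?trace_norm_ge0 // normrM normr_id -trW -normrM.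
by rewrite -mxtraceZ scalemxAr trace_contraction_le.
Qed.

Lemma trace_normN d (A : 'M[C]_d) : trace_norm (- A) = trace_norm A.
Proof.
have N_ge B : trace_norm B <= trace_norm (- B).
  by have := trace_norm_scale_ge (-1) B; rewrite normrN1 mul1r scaleN1r.
by apply/eqP; rewrite eq_le N_ge andbT -[X in _ <= trace_norm X]opprK N_ge.
Qed.

(** Contractions optimal for the two diagonal blocks of M assemble into a block-diagonal matrix W.
    It is again a contraction, so it is a test for M, and Tr (W M) is the sum of the two block
    norms. *)
Lemma trace_norm_pinching d e1 e2 (J1 : 'M[C]_(d, e1)) (J2 : 'M[C]_(d, e2)) (M : 'M[C]_d) :
    J1^t* *m J1 = 1%:M -> J2^t* *m J2 = 1%:M -> J1^t* *m J2 = 0 ->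
    J1 *m J1^t* + J2 *m J2^t* = 1%:M ->
  trace_norm (J1^t* *m M *m J1) + trace_norm (J2^t* *m M *m J2) <= trace_norm M.
Proof.
move=> J11 J22 J12 Jsum.
have J21 : J2^t* *m J1 = 0.
  by rewrite -[LHS]trmxCK trmxC_mul trmxCK J12 trmx0 map_mx0.
have [W1 contrW1 trW1] := trace_contraction_attained (J1^t* *m M *m J1).
have [W2 contrW2 trW2] := trace_contraction_attained (J2^t* *m M *m J2).
pose W := J1 *m W1 *m J1^t* + J2 *m W2 *m J2^t*.
have trW : \tr (W *m M) = trace_norm (J1^t* *m M *m J1) + trace_norm (J2^t* *m M *m J2).
  rewrite -trW1 -trW2 mulmxDl mxtraceD; congr (_ + _);
    by rewrite -!mulmxA mxtrace_mulC !mulmxA.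
rewrite -trW -[leLHS]ger0_norm; last by rewrite trW addr_ge0 ?trace_norm_ge0.
apply: trace_contraction_le => u.
(* Pythagoras: by [Jsum] the two ranges decompose the whole space. For u W the cross terms vanish by
   [J12] and [J21]. *)
have -> : '[u] = '[u *m J1] + '[u *m J2].
  rewrite !dotmxE !trmxC_mul; set v := u^t*.
  by rewrite -[u in LHS]mulmx1 -Jsum mulmxDr mulmxDl !mulmxA [LHS]mxE.
apply: le_trans (lerD (contrW1 _) (contrW2 _)); rewrite !dotmxE.
pose y1 := u *m J1 *m W1; pose y2 := u *m J2 *m W2.
have -> : u *m W = y1 *m J1^t* + y2 *m J2^t* by rewrite mulmxDr !mulmxA.
rewrite trmxCD (trmxC_mul y1) (trmxC_mul y2) !trmxCK mulmxDl !mulmxDr.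
rewrite -!(mulmxA y1) -!(mulmxA y2) !(mulmxA (J1^t*)) !(mulmxA (J2^t*)) J11 J22 J12 J21.
by rewrite !mul1mx !mul0mx !mulmx0 addr0 add0r mxE.
Qed.

(** * Matrices induced by maps between basis sets *)

Section Isometries.
Variable F : numClosedFieldType.

(** The linear map that sends the basis vector of s to that of e s. Oracles, register embeddings and
    the coin flip are all of this form, so identities between them reduce to identities between
    maps. *)
Definition emb_mx (S T : finType) (e : S -> T) : 'M[F]_(#|T|, #|S|) :=
  \matrix_(i, j) (enum_val i == e (enum_val j))%:R.

Lemma emb_mxM (R S T : finType) (e : S -> T) (e' : R -> S) :
  emb_mx e *m emb_mx e' = emb_mx (e \o e').
Proof.
apply/matrixP=> i j; rewrite !mxE (reindex enum_rank) /=; last exact/onW_bij/enum_rank_bij.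
rewrite (bigD1 (e' (enum_val j))) //= !mxE enum_rankK eqxx mulr1 big1 ?addr0 // => s nes.
by rewrite !mxE enum_rankK (negPf nes) mulr0.
Qed.

Lemma eq_emb_mx (S T : finType) (e e' : S -> T) : e =1 e' -> emb_mx e = emb_mx e'.
Proof. by move=> eqe; apply/matrixP=> i j; rewrite !mxE eqe. Qed.

Lemma emb_mx_id (T : finType) : emb_mx (@id T) = 1%:M.
Proof. by apply/matrixP=> i j; rewrite !mxE (inj_eq enum_val_inj). Qed.

Lemma trmxC_emb_mulE (R S T : finType) (e : S -> T) (e' : R -> T) :
  (emb_mx e)^t* *m emb_mx e' = \matrix_(i, j) (e (enum_val i) == e' (enum_val j))%:R.
Proof.
apply/matrixP=> i j; rewrite !mxE (reindex enum_rank) /=; last exact/onW_bij/enum_rank_bij.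
rewrite (bigD1 (e (enum_val i))) //= !mxE enum_rankK eqxx rmorph1 mul1r.
rewrite big1 ?addr0 // => t net.
by rewrite !mxE enum_rankK (negPf net) rmorph0 mul0r.
Qed.

Lemma emb_mx_conj (S T : finType) (e : S -> T) (M : 'M[F]_#|T|) i j :
  ((emb_mx e)^t* *m M *m emb_mx e) i j
  = M (enum_rank (e (enum_val i))) (enum_rank (e (enum_val j))).
Proof.
have mulr m (N : 'M[F]_(m, #|T|)) k : (N *m emb_mx e) k j = N k (enum_rank (e (enum_val j))).
  rewrite mxE (reindex enum_rank) /=; last exact/onW_bij/enum_rank_bij.
  rewrite (bigD1 (e (enum_val j))) //= mxE enum_rankK eqxx mulr1 big1 ?addr0 // => t net.
  by rewrite mxE enum_rankK (negPf net) mulr0.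
rewrite mulr mxE (reindex enum_rank) /=; last exact/onW_bij/enum_rank_bij.
rewrite (bigD1 (e (enum_val i))) //= !mxE enum_rankK eqxx rmorph1 mul1r.
rewrite big1 ?addr0 // => t net.
by rewrite !mxE enum_rankK (negPf net) rmorph0 mul0r.
Qed.

Lemma emb_mx_isometry (S T : finType) (e : S -> T) :
  injective e -> (emb_mx e)^t* *m emb_mx e = 1%:M.
Proof.
move=> inje; rewrite trmxC_emb_mulE; apply/matrixP=> i j.
by rewrite !mxE (inj_eq inje) (inj_eq enum_val_inj).
Qed.

Lemma emb_mx_ortho (R S T : finType) (e : S -> T) (e' : R -> T) :
  (forall s r, e s != e' r) -> (emb_mx e)^t* *m emb_mx e' = 0.
Proof.
move=> dis; rewrite trmxC_emb_mulE; apply/matrixP=> i j.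
by rewrite !mxE (negPf (dis _ _)).
Qed.

(** This is the orthogonal projection onto the span of the image of e, hence diagonal in the
    basis. *)
Lemma emb_mx_proj (S T : finType) (e : S -> T) : injective e ->
  emb_mx e *m (emb_mx e)^t* = \matrix_(i, j) ((i == j) && (enum_val i \in codom e))%:R.
Proof.
move=> inje; apply/matrixP=> i j; rewrite !mxE.
rewrite (reindex enum_rank) /=; last exact/onW_bij/enum_rank_bij.
have termE s : emb_mx e i (enum_rank s) * (emb_mx e)^t* (enum_rank s) j
    = ((enum_val i == e s) && (i == j))%:R.
  rewrite !mxE enum_rankK rmorph_nat -natrM mulnb -(inj_eq enum_val_inj).
  by case: (eqVneq (enum_val i) (e s)) => // ->; rewrite (eq_sym (e s)).
under eq_bigr do rewrite termE.
have [/codomP[s ei]|nei] := boolP (enum_val i \in codom e); last first.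
  rewrite andbF big1 // => s _; rewrite (_ : _ == _ = false) //.
  by apply: contraNF nei => /eqP ->; apply: codom_f.
rewrite (bigD1 s) //= ei eqxx andbT big1 ?addr0 // => r ner.
by rewrite (inj_eq inje) eq_sym (negPf ner).
Qed.

Lemma emb_mx_col (S T : finType) (e : S -> T) (v : 'cV[F]_#|S|) t :
  (emb_mx e *m v) t 0 = \sum_s (enum_val t == e s)%:R * v (enum_rank s) 0.
Proof.
rewrite mxE (reindex enum_rank) /=; last exact/onW_bij/enum_rank_bij.
by apply: eq_bigr => s _; rewrite mxE enum_rankK.
Qed.

Lemma emb_mx_col_image (S T : finType) (e : S -> T) (v : 'cV[F]_#|S|) s :
  injective e -> (emb_mx e *m v) (enum_rank (e s)) 0 = v (enum_rank s) 0.
Proof.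
move=> inje; rewrite emb_mx_col enum_rankK (bigD1 s) //= eqxx mul1r big1 ?addr0 //.
by move=> r ner; rewrite (inj_eq inje) eq_sym (negPf ner) mul0r.
Qed.

Lemma emb_mx_col_out (S T : finType) (e : S -> T) (v : 'cV[F]_#|S|) t :
  (forall s, e s != t) -> (emb_mx e *m v) (enum_rank t) 0 = 0.
Proof.
move=> out; rewrite emb_mx_col enum_rankK big1 // => s _.
by rewrite eq_sym (negPf (out s)) mul0r.
Qed.

Lemma mulmxBlr m n p q (P : 'M[F]_(m, n)) (M N : 'M[F]_(n, p)) (Q : 'M[F]_(p, q)) :
  P *m (M - N) *m Q = P *m M *m Q - P *m N *m Q.
Proof. by rewrite mulmxBr mulmxBl. Qed.

Lemma mulmx_lin2 m n p (M : 'M[F]_(m, n)) c c' (u v : 'M[F]_(n, p)) :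
  M *m (c *: u + c' *: v) = c *: (M *m u) + c' *: (M *m v).
Proof. by rewrite mulmxDr -!scalemxAr. Qed.

(** * Unitaries acting blockwise on two orthogonal ranges, and the coin *)

Section Glue.
Variables (d d1 d2 : nat) (E1 : 'M[F]_(d, d1)) (E2 : 'M[F]_(d, d2)).
Hypotheses (E11 : E1^t* *m E1 = 1%:M) (E22 : E2^t* *m E2 = 1%:M) (E12 : E1^t* *m E2 = 0).

(** The last summand is the identity on the orthogonal complement of both ranges: an enlarged
    register may have basis states that belong to neither algorithm. *)
Definition glue_mx (U1 : 'M[F]_d1) (U2 : 'M[F]_d2) : 'M[F]_d :=
  E1 *m U1 *m E1^t* + E2 *m U2 *m E2^t* + (1%:M - E1 *m E1^t* - E2 *m E2^t*).

Let E21 : E2^t* *m E1 = 0.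
Proof. by rewrite -[LHS]trmxCK trmxC_mul trmxCK E12 trmx0 map_mx0. Qed.

Lemma glue_mx1 U1 U2 : glue_mx U1 U2 *m E1 = E1 *m U1.
Proof.
rewrite /glue_mx !mulmxDl !mulNmx -!mulmxA E11 E21 !mulmx0 !mulmx1 mul1mx.
by rewrite !addr0 subr0 subrr addr0.
Qed.

Lemma glue_mx2 U1 U2 : glue_mx U1 U2 *m E2 = E2 *m U2.
Proof.
rewrite /glue_mx !mulmxDl !mulNmx -!mulmxA E12 E22 !mulmx0 !mulmx1 mul1mx.
by rewrite add0r subr0 subrr addr0.
Qed.

Lemma glue_mx_lin U1 U2 n c1 c2 (v1 : 'M[F]_(d1, n)) (v2 : 'M[F]_(d2, n)) :
  glue_mx U1 U2 *m (c1 *: (E1 *m v1) + c2 *: (E2 *m v2))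
  = c1 *: (E1 *m (U1 *m v1)) + c2 *: (E2 *m (U2 *m v2)).
Proof. by rewrite mulmx_lin2 !mulmxA glue_mx1 glue_mx2. Qed.

Lemma glue_mx_unitary U1 U2 :
  U1 \is unitarymx -> U2 \is unitarymx -> glue_mx U1 U2 \is unitarymx.
Proof.
move=> /unitarymxP U11 /unitarymxP U22; apply/unitarymxP.
set X := glue_mx U1 U2.
have -> : X^t* = E1 *m (U1^t* *m E1^t*) + E2 *m (U2^t* *m E2^t*)
                 + (1%:M - E1 *m E1^t* - E2 *m E2^t*).
  by rewrite /X /glue_mx !trmxCD !trmxCN !trmxC_mul !trmxCK trmxC1 !mulmxA.
rewrite !mulmxDr !mulmxN mulmx1 !(mulmxA X) glue_mx1 glue_mx2.
rewrite !mulmxA -(mulmxA E1 U1) -(mulmxA E2 U2) U11 U22 !mulmx1 /X /glue_mx.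
set P := E1 *m E1^t*; set Q := E2 *m E2^t*.
set P' := _ *m E1^t*; set Q' := _ *m E2^t*.
(* The left side is X (1 - P - Q), because X P = P' and X Q = Q'. Adding the contributions P and Q
   of the two ranges then gives the identity. *)
have -> : P' + Q' + (1%:M - P - Q) - P' - Q' = 1%:M - P - Q.
  by rewrite -[LHS]addrA -opprD addrAC subrr add0r.
by rewrite -[1%:M - P - Q]addrA -opprD subrKC.
Qed.

End Glue.

(* [coin_amp] and its conjugate both have modulus 1/sqrt 2, and for a Hermitian involution X
   the matrix [coin_mx X] is unitary: it is the square root of NOT when X is NOT. *)
Definition coin_amp : F := (1 + 'i) / 2%:R.

Lemma coin_ampC : coin_amp^* = (1 - 'i) / 2%:R.
Proof. by rewrite rmorphM fmorphV rmorphD /= rmorph1 conjCi rmorph_nat. Qed.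

Lemma coin_amp_norm : coin_amp * coin_amp^* = 2%:R^-1.
Proof.
have -> : coin_amp * coin_amp^* = (1 - 'i ^+ 2) / 2%:R / 2%:R.
  by rewrite coin_ampC /coin_amp; field.
by rewrite sqrCi opprK -[1 + 1]/(2%:R) divff ?pnatr_eq0 // mul1r.
Qed.

(** The left side is the coefficient of X in [coin_mx X] times its adjoint. *)
Lemma coin_amp_sq : coin_amp * coin_amp + coin_amp^* * coin_amp^* = 0.
Proof.
have -> : coin_amp * coin_amp + coin_amp^* * coin_amp^* = (1 + 'i ^+ 2) / 2%:R.
  by rewrite coin_ampC /coin_amp; field.
by rewrite sqrCi subrr mul0r.
Qed.

(** Unlike a Hadamard gate, this has no basis-dependent sign, so one permutation matrix determines
    it. The phases of the amplitudes are harmless, as only their squared moduli enter the diagonal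
    blocks of the output. *)
Definition coin_mx d (X : 'M[F]_d) : 'M[F]_d := coin_amp *: 1%:M + coin_amp^* *: X.

Lemma coin_mx_col d (X : 'M[F]_d) n (v : 'M[F]_(d, n)) :
  coin_mx X *m v = coin_amp *: v + coin_amp^* *: (X *m v).
Proof. by rewrite /coin_mx mulmxDl -!scalemxAl mul1mx. Qed.

Lemma coin_unitary d (X : 'M[F]_d) : X^t* = X -> X *m X = 1%:M -> coin_mx X \is unitarymx.
Proof.
move=> Xt XX; apply/unitarymxP.
rewrite trmxCD !trmxCZ Xt trmxC1 conjCK mulmxDl !mulmxDr -!scalemxAl -!scalemxAr !scalerA.
rewrite !mulmx1 !mul1mx XX [coin_amp^* * coin_amp^* *: _ + _]addrC addrACA -!scalerDl.
rewrite coin_amp_sq [coin_amp^* * _]mulrC coin_amp_norm scale0r addr0.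
have -> : 2%:R^-1 + 2%:R^-1 = 1 :> F by field.
by rewrite scale1r.
Qed.

End Isometries.

(** * Partial trace and its invariance under the oracle *)

Definition rest (q g : nat) : finType := ('I_(2 ^ q) * bool * {ffun 'I_g -> bool})%type.

Definition join_out q p g (r : rest q g) (o : outb p) : basis q p g :=
  (r.1.1, r.1.2, (o, r.2)).

Lemma reduceE q p g (psi : 'cV[C]_(dim q p g)) a a' :
  reduce psi a a' = \sum_(r : rest q g)
    psi (enum_rank (join_out r (enum_val a))) 0
    * (psi (enum_rank (join_out r (enum_val a'))) 0)^*.
Proof.
rewrite mxE pair_bigA /= pair_bigA /=.
by apply: eq_bigr => -[[i b] r] _.
Qed.

Lemma oracle_mapK n q p g (x : {ffun 'I_n -> bool}) :
  involutive (@oracle_map n q p g x).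
Proof. by case=> [[i b] r]; rewrite /oracle_map -addbA addbb addbF. Qed.

Lemma oracle_mxE n q p g (x : {ffun 'I_n -> bool}) :
  @oracle_mx n q p g x = emb_mx C (@oracle_map n q p g x).
Proof. by []. Qed.

Lemma reduce_oracle n q p g (x : {ffun 'I_n -> bool}) (psi : 'cV[C]_(dim q p g)) :
  reduce (oracle_mx q p g x *m psi) = reduce psi.
Proof.
(* The oracle only permutes the basis of the traced-out registers, by [h], so the sum defining the
   partial trace is merely reindexed. *)
pose h (r : rest q g) : rest q g := (r.1.1, r.1.2 (+) qbit x r.1.1, r.2).
have hK : involutive h by case=> [[i b] r]; rewrite /h /= -addbA addbb addbF.
apply/matrixP=> a a'; rewrite !reduceE [RHS](reindex_inj (inv_inj hK)) /=.
have coord r o : (oracle_mx q p g x *m psi) (enum_rank (join_out r o)) 0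
    = psi (enum_rank (join_out (h r) o)) 0.
  have -> : join_out r o = oracle_map x (join_out (h r) o).
    by rewrite /join_out /= -addbA addbb addbF; case: r => [[]].
  by rewrite oracle_mxE emb_mx_col_image //; apply/inv_inj/oracle_mapK.
by apply: eq_bigr => r _; rewrite !coord.
Qed.

(** * Embedding registers into larger ones, with the coin as first output bit *)

Definition ext_bits g0 g (r : {ffun 'I_g0 -> bool}) : {ffun 'I_g -> bool} :=
  [ffun k : 'I_g => if insub (k : nat) is Some j then r j else false].

Definition ext_out p (c : bool) (o : outb p) : outb p.+1 :=
  [ffun k => if unlift ord0 k is Some j then o j else c].

Lemma ext_bits_inj g0 g : (g0 <= g)%N -> injective (@ext_bits g0 g).
Proof.
move=> le_g r r' /ffunP eqr; apply/ffunP=> j.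
by have := eqr (widen_ord le_g j); rewrite !ffunE /= valK.
Qed.

Lemma ext_out_inj p c : injective (@ext_out p c).
Proof.
move=> o o' /ffunP eqo; apply/ffunP=> j.
by have := eqo (lift ord0 j); rewrite !ffunE liftK.
Qed.

Lemma ext_out_ord0 p c (o : outb p) : ext_out c o ord0 = c.
Proof. by rewrite ffunE unlift_none. Qed.

Lemma ext_out_neq p (o o' : outb p) : ext_out false o != ext_out true o'.
Proof. by apply/eqP=> /ffunP/(_ ord0); rewrite !ext_out_ord0. Qed.

Lemma ext_outP p (o : outb p.+1) :
  o = ext_out (o ord0) [ffun j => o (lift ord0 j)].
Proof.
by apply/ffunP=> k; rewrite ffunE; case: unliftP => [j ->|->]; rewrite ?ffunE.
Qed.

Section Register.
Variables (q0 q g0 g : nat) (le_q : (2 ^ q0 <= 2 ^ q)%N) (le_g : (g0 <= g)%N).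

Definition ext_rest (r : rest q0 g0) : rest q g :=
  (widen_ord le_q r.1.1, r.1.2, ext_bits g r.2).

Definition ext_basis p (c : bool) (s : basis q0 p g0) : basis q p.+1 g :=
  (widen_ord le_q s.1.1, s.1.2, (ext_out c s.2.1, ext_bits g s.2.2)).

Lemma ext_rest_inj : injective ext_rest.
Proof.
by move=> [[i b] r] [[i' b'] r'] [/val_inj -> -> /(ext_bits_inj le_g) ->].
Qed.

Lemma ext_basis_inj p c : injective (@ext_basis p c).
Proof.
by move=> [[i b] [o r]] [[i' b'] [o' r']]
  [/val_inj -> -> /ext_out_inj -> /(ext_bits_inj le_g) ->].
Qed.

(** Widening the index register keeps the numerical value of the index, on which alone the query bit
    depends. Hence one query on the large register serves both branches at once. *)
Lemma oracle_ext_basis n p c (x : {ffun 'I_n -> bool}) (s : basis q0 p g0) :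
  oracle_map x (ext_basis c s) = ext_basis c (oracle_map x s).
Proof. by case: s => [[i b] [o r]]. Qed.

Lemma ext_basis_zero p c :
  ext_basis c (zero_basis q0 p g0) = (idx0 q, false, (ext_out c [ffun=> false], [ffun=> false])).
Proof.
congr (_, _, (_, _)); first exact: val_inj.
by apply/ffunP=> k; rewrite !ffunE; case: insub => // j; rewrite ffunE.
Qed.

(** Here [om] stands for the branch with the other coin value: it has no component with coin c, so
    the block at c sees only [phi], with weight the squared modulus of [gam]. *)
Lemma reduce_ext_basis p c (gam : C) (phi : 'cV[C]_(dim q0 p g0))
    (om : 'cV[C]_(dim q p.+1 g)) :
    (forall r o, om (enum_rank (join_out r (ext_out c o))) 0 = 0) ->
  (emb_mx C (@ext_out p c))^t* *m reduce (gam *: (emb_mx C (@ext_basis p c) *m phi) + om)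
    *m emb_mx C (@ext_out p c) = (gam * gam^*) *: reduce phi.
Proof.
move=> om0; apply/matrixP=> a a'.
set psi := _ + om; rewrite emb_mx_conj.
rewrite reduceE [RHS]mxE reduceE mulr_sumr !enum_rankK.
have coord r o : psi (enum_rank (join_out (ext_rest r) (ext_out c o))) 0
    = gam * phi (enum_rank (join_out r o)) 0.
  rewrite mxE om0 addr0 mxE -[join_out _ _]/(ext_basis c (join_out r o)).
  by rewrite emb_mx_col_image //; apply: ext_basis_inj.
have coord0 r o : r \notin codom ext_rest -> psi (enum_rank (join_out r (ext_out c o))) 0 = 0.
  move=> nr; rewrite mxE om0 addr0 mxE emb_mx_col_out ?mulr0 // => s.
  apply: contraNneq nr => eqs; apply/codomP; exists (s.1.1, s.1.2, s.2.2).
  by case: r eqs => [[i b] r] [<- <- _ <-].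
(* Traced-out states outside the image of [ext_rest] have amplitude 0 by [coord0]; the others
   correspond to those of the small register. *)
rewrite (bigID (mem (codom ext_rest))) /= [X in _ + X]big1 ?addr0; last first.
  by move=> r /coord0 ->; rewrite mul0r.
have codomE : mem (codom ext_rest) =1 mem [set ext_rest r | r in predT].
  move=> r /=; apply/codomP/imsetP => [[r' ->]|[r' _ ->]]; by exists r'.
rewrite (eq_bigl _ _ codomE) big_imset /=; last exact: in2W ext_rest_inj.
by apply: eq_bigr => r _; rewrite !coord rmorphM /= mulrACA.
Qed.

End Register.

(** * Runs indexed by natural numbers, padded to a common length *)

Fixpoint run n q p g (U : nat -> 'M[C]_(dim q p g)) (x : {ffun 'I_n -> bool}) k :
    'cV[C]_(dim q p g) :=
  match k with
  | 0 => U 0%N *m init_vec q p g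
  | k'.+1 => U k'.+1 *m (oracle_mx q p g x *m run U x k')
  end.

(* After its last query the algorithm idles (U = 1); further oracle calls only
   act on registers that are traced out, see [reduce_oracle]. *)
Definition pad n p (A : qalg n p) t : 'M[C]_(dim (qa_q A) p (qa_g A)) :=
  if (t <= qa_T A)%N then qa_U (inord t) else 1%:M.

Lemma pad_unitary n p (A : qalg n p) t : pad A t \is unitarymx.
Proof.
rewrite /pad; case: ifP => _; first exact: qa_unitary.
by apply/unitarymxP; rewrite trmxC1 mulmx1.
Qed.

Lemma qa_run_eq n p (A : qalg n p) U x k :
  (forall t, (t <= k)%N -> qa_U (inord t) = U t) -> qa_run A x k = run U x k.
Proof.
elim: k => [|k IHk] eqU /=; first by rewrite eqU.
by rewrite eqU // IHk // => t le_tk; rewrite eqU // ltnW.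
Qed.

Lemma reduce_run_pad n p (A : qalg n p) x k :
  (qa_T A <= k)%N -> reduce (run (pad A) x k) = qa_output A x.
Proof.
move=> /subnK <-; elim: (k - _)%N => [|j IHj].
  by rewrite /qa_output /qa_state (@qa_run_eq _ _ _ (pad A)) // => t le_t; rewrite /pad le_t.
by rewrite addSn /= {1}/pad leqNgt ltnS leq_addl /= mul1mx reduce_oracle.
Qed.

Lemma emb_mx_init q0 p0 g0 (T : finType) (e : basis q0 p0 g0 -> T) :
  emb_mx C e *m init_vec q0 p0 g0 = \col_i (enum_val i == e (zero_basis q0 p0 g0))%:R.
Proof.
apply/matrixP=> i j; rewrite ord1 emb_mx_col mxE (bigD1 (zero_basis q0 p0 g0)) //=.
rewrite mxE enum_rankK eqxx mulr1 big1 ?addr0 // => s nes.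
by rewrite mxE enum_rankK (negPf nes) mulr0.
Qed.

(** * The coin-controlled combination of two algorithms *)

Section Mix.
Variables (n p : nat) (A B : qalg n p).
Let q := maxn (qa_q A) (qa_q B).
Let g := maxn (qa_g A) (qa_g B).

Let le_qA : (2 ^ qa_q A <= 2 ^ q)%N. Proof. by rewrite leq_exp2l // leq_maxl. Qed.
Let le_qB : (2 ^ qa_q B <= 2 ^ q)%N. Proof. by rewrite leq_exp2l // leq_maxr. Qed.
Let le_gA : (qa_g A <= g)%N. Proof. exact: leq_maxl. Qed.
Let le_gB : (qa_g B <= g)%N. Proof. exact: leq_maxr. Qed.

Let eA := @ext_basis _ _ (qa_g A) g le_qA p false.
Let eB := @ext_basis _ _ (qa_g B) g le_qB p true.
Let EA := emb_mx C eA.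
Let EB := emb_mx C eB.

Let eAB s r : eA s != eB r.
Proof.
by apply/eqP=> -[_ _ /eqP]; rewrite (negPf (ext_out_neq _ _)).
Qed.

Let EAA : EA^t* *m EA = 1%:M. Proof. exact/emb_mx_isometry/ext_basis_inj. Qed.
Let EBB : EB^t* *m EB = 1%:M. Proof. exact/emb_mx_isometry/ext_basis_inj. Qed.
Let EAB : EA^t* *m EB = 0. Proof. exact: emb_mx_ortho. Qed.

Let flip (s : basis q p.+1 g) : basis q p.+1 g :=
  (s.1, ([ffun k => (k == ord0) (+) s.2.1 k], s.2.2)).

Let flipK : involutive flip.
Proof.
case=> s [o r]; congr (_, (_, _)); apply/ffunP=> k.
by rewrite !ffunE addbA addbb.
Qed.

Let flip_zero : flip (eA (zero_basis _ p _)) = eB (zero_basis _ p _).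
Proof.
rewrite /eA /eB !ext_basis_zero /flip /=; congr (_, (_, _)).
apply/ffunP=> k; rewrite !ffunE.
by case: unliftP => [j ->|->]; rewrite ?eqxx // ffunE.
Qed.

(** The right factor is applied first: the coin is tossed once, at time 0, and from then on selects
    which algorithm acts. *)
Definition mix_mx t : 'M[C]_(dim q p.+1 g) :=
  glue_mx EA EB (pad A t) (pad B t) *m
    (if t == 0%N then coin_mx (emb_mx C flip) else 1%:M).

Lemma mix_mx_unitary t : mix_mx t \is unitarymx.
Proof.
apply: mul_unitarymx; first by apply: glue_mx_unitary => //; apply: pad_unitary.
case: ifP => _; last by apply/unitarymxP; rewrite trmxC1 mulmx1.
have flipV : emb_mx C flip *m emb_mx C flip = 1%:M.
  by rewrite emb_mxM (eq_emb_mx _ flipK) emb_mx_id.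
apply: coin_unitary => //; rewrite -[LHS]mulmx1 -flipV mulmxA.
by rewrite emb_mx_isometry ?mul1mx //; apply: inv_inj flipK.
Qed.

Lemma mix_index_ok : (n <= 2 ^ q)%N.
Proof. exact: leq_trans (qa_index_ok A) le_qA. Qed.

Definition mix_alg : qalg n p.+1 :=
  @QAlg n p.+1 q g (maxn (qa_T A) (qa_T B)) (fun t => mix_mx t)
    mix_index_ok (fun t => mix_mx_unitary t).

(** The two branches evolve independently: the glued unitaries act on each range separately, and the
    oracle commutes with both embeddings. *)
Lemma run_mix (x : {ffun 'I_n -> bool}) k : run mix_mx x k =
  coin_amp C *: (EA *m run (pad A) x k) + (coin_amp C)^* *: (EB *m run (pad B) x k).
Proof.
have zeroA : eA (zero_basis _ p _) = zero_basis q p.+1 g.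
  rewrite /eA ext_basis_zero; congr (_, (_, _)); apply/ffunP=> i.
  by rewrite !ffunE; case: unlift => // j; rewrite ffunE.
have zeroB : eB (zero_basis _ p _) = flip (zero_basis q p.+1 g) by rewrite -zeroA flip_zero.
have oracleA : oracle_mx q p.+1 g x *m EA = EA *m oracle_mx _ p _ x.
  by rewrite !oracle_mxE !emb_mxM; apply: eq_emb_mx => s; apply: oracle_ext_basis.
have oracleB : oracle_mx q p.+1 g x *m EB = EB *m oracle_mx _ p _ x.
  by rewrite !oracle_mxE !emb_mxM; apply: eq_emb_mx => s; apply: oracle_ext_basis.
elim: k => [|k IHk] /=.
  (* At time 0 it remains to see that the coin turns the initial state into the superposition of the
     two embedded initial states. *)
  rewrite -(glue_mx_lin EAA EBB EAB) /mix_mx eqxx -mulmxA.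
  congr (_ *m _); rewrite coin_mx_col.
  have -> : EB *m init_vec _ p _ = emb_mx C flip *m init_vec q p.+1 g.
    by rewrite !emb_mx_init zeroB.
  have -> : EA *m init_vec _ p _ = init_vec q p.+1 g by rewrite emb_mx_init zeroA.
  by [].
rewrite -(glue_mx_lin EAA EBB EAB) {1}/mix_mx mulmx1 IHk; congr (_ *m _).
by rewrite mulmx_lin2 [_ *m (EA *m _)]mulmxA [_ *m (EB *m _)]mulmxA oracleA oracleB -!mulmxA.
Qed.

Let output_mixE x : qa_output mix_alg x = reduce (run mix_mx x (maxn (qa_T A) (qa_T B))).
Proof.
rewrite /qa_output /qa_state; congr reduce; apply: (@qa_run_eq _ _ mix_alg).
by move=> t le_t /=; rewrite inordK.
Qed.

Let other_branch_eq0 gam c d q0 g0 le (phi : 'cV[C]_(dim q0 p g0)) r o :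
  c != d -> (gam *: (emb_mx C (@ext_basis q0 q g0 g le p d) *m phi))
    (enum_rank (join_out r (ext_out c o))) 0 = 0.
Proof.
move=> necd; rewrite mxE emb_mx_col_out ?mulr0 // => s.
apply: contraNneq necd => -[_ _ /ffunP/(_ ord0)].
by rewrite !ext_out_ord0 => ->.
Qed.

Lemma output_mix_l x :
  (emb_mx C (@ext_out p false))^t* *m qa_output mix_alg x *m emb_mx C (@ext_out p false)
  = 2%:R^-1 *: qa_output A x.
Proof.
rewrite output_mixE run_mix reduce_ext_basis // => [|r o]; last exact: other_branch_eq0.
by rewrite coin_amp_norm reduce_run_pad ?leq_maxl.
Qed.

Lemma output_mix_r x :
  (emb_mx C (@ext_out p true))^t* *m qa_output mix_alg x *m emb_mx C (@ext_out p true)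
  = 2%:R^-1 *: qa_output B x.
Proof.
rewrite output_mixE run_mix addrC reduce_ext_basis // => [|r o]; last exact: other_branch_eq0.
by rewrite conjCK mulrC coin_amp_norm reduce_run_pad ?leq_maxr.
Qed.

Lemma trace_norm_mix_ge x y :
  (trace_norm (qa_output A x - qa_output A y) + trace_norm (qa_output B x - qa_output B y))
    / 2%:R <= trace_norm (qa_output mix_alg x - qa_output mix_alg y).
Proof.
pose J c := emb_mx C (@ext_out p c).
(* Every output basis state has exactly one coin value, so the two block projections add up to 1. *)
have Jsum : J false *m (J false)^t* + J true *m (J true)^t* = 1%:M.
  have codom_ext c (o : outb p.+1) : (o \in codom (@ext_out p c)) = (o ord0 == c).
    apply/codomP/eqP => [[o' ->]|<-]; first exact: ext_out_ord0.
    by exists [ffun j => o (lift ord0 j)]; apply: ext_outP.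
  rewrite !emb_mx_proj; try exact: ext_out_inj.
  apply/matrixP=> i j; rewrite !mxE !codom_ext.
  by case: (i == j); case: (enum_val i ord0); rewrite ?addr0 ?add0r.
have J01 : (J false)^t* *m J true = 0 by apply: emb_mx_ortho => o o'; apply: ext_out_neq.
have JJ c : (J c)^t* *m J c = 1%:M by apply/emb_mx_isometry/ext_out_inj.
apply: le_trans (trace_norm_pinching _ (JJ false) (JJ true) J01 Jsum).
rewrite !mulmxBlr !output_mix_l !output_mix_r -!scalerBr mulrDl.
have half_norm : `|2%:R^-1| = 2%:R^-1 :> C by rewrite ger0_norm ?invr_ge0 ?ler0n.
by apply: lerD; rewrite mulrC -[X in X * _]half_norm trace_norm_scale_ge.
Qed.

End Mix.

(** * From the coin bound to distance 1/6 *)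

Lemma trace_distC d (rho sigma : 'M[C]_d) : trace_dist rho sigma = trace_dist sigma rho.
Proof. by rewrite /trace_dist -trace_normN opprB. Qed.

Lemma trace_dist_mix_ge n p (A B : qalg n p) x y :
    2%:R / 3%:R <= trace_dist (qa_output A x) (qa_output B x) ->
    trace_dist (qa_output A y) (qa_output B y) <= 1 / 3%:R ->
  1 / 6%:R <= trace_dist (qa_output (mix_alg A B) x) (qa_output (mix_alg A B) y).
Proof.
have gt0_2 : 0 < 2%:R :> C by rewrite ltr0n.
rewrite /trace_dist ler_pdivlMr // ler_pdivrMr // => far near.
rewrite ler_pdivlMr //; apply: le_trans (trace_norm_mix_ge _ _ _ _).
rewrite ler_pdivlMr //.
set a := trace_norm (qa_output A x - _); set b := trace_norm (qa_output B x - _).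
have : trace_norm (qa_output A x - qa_output B x)
    <= a + trace_norm (qa_output A y - qa_output B y) + b.
  have -> : qa_output A x - qa_output B x = (qa_output A x - qa_output A y)
      + (qa_output A y - qa_output B y) + (qa_output B y - qa_output B x).
    by rewrite !addrA !subrK.
  apply: le_trans (ler_trace_normD _ _) _; apply: lerD; first exact: ler_trace_normD.
  by rewrite -trace_normN opprB.
move=> /(le_trans far) tri.
have := le_trans tri (lerD (lerD (lexx a) near) (lexx b)).
(* In trace norms the gap is 4/3 - 2/3. Of the two factors 2 on the right, one comes from the trace
   distance and one from the coin weight. *)
have cst : 2%:R / 3%:R * 2%:R - 1 / 3%:R * 2%:R = 1 / 6%:R * 2%:R * 2%:R :> C by field.
by rewrite addrAC -lerBlDr cst.
Qed.

Theorem theorem2 (n : nat) (D : {set {ffun 'I_n -> bool}})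
  (f : {ffun 'I_n -> bool} -> bool) : QS_le_QSZK D f.
Proof.
move=> k [p [A [B [<- [far near]]]]].
(* Sharing each query between the branches costs the maximum of the two query counts, which is at
   most their sum. *)
exists (maxn (qa_T A) (qa_T B)); first by rewrite geq_max leq_addr leq_addl.
exists p.+1, (mix_alg A B); split=> // x y Dx Dy.
have [fx|fx] := boolP (f x); have [fy|fy] //= := boolP (f y) => _.
  by apply: trace_dist_mix_ge; [apply: far | apply: near].
by rewrite trace_distC; apply: trace_dist_mix_ge; [apply: far | apply: near].
Qed.
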